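(* Let $\mathcal{M}_\Omega$ be a nonparametric missing data model with partially observed variables $\mathbf{X}$, $|\mathbf{X}|=n$. If there exists an ordering $X_{(1)}\prec\cdots\prec X_{(n)}$ of the variables in $\mathbf{X}$ such that $X_{(1)}\perp R_{X_{(1)}}$ and $$X_{(j)}\perp \bigl(R_{X_{(j)}},R_{\mathbf{X}_{\prec(j)}}\bigr)\mid \mathbf{X}_{\prec(j)}\qquad\text{for all } j=2,\ldots,n,$$ then a directly factorizable imputation method (with respect to this ordering) exists.
   Context: Variables and missing data model. $\mathbf{X}$ is a finite set of random variables that may be missing. Each $X\in\mathbf{X}$ has a binary response indicator $R_X\in\{0,1\}$ and a proxy variable $X^\ast$ with $X^\ast = X$ if $R_X=1$ and $X^\ast=\mathrm{NA}$ (missing) if $R_X=0$. $\mathbf{R}$ and $\mathbf{X}^\ast$ are the sets of all response indicators and all proxies. It is assumed that there are no additional fully observed variables. For $\mathbf{Y}\subseteq\mathbf{X}$, $R_{\mathbf{Y}}$ denotes the collection of indicators $R_Y$, $Y\in\mathbf{Y}$. A missing data model is a set of joint distributions of $(\mathbf{X},\mathbf{X}^\ast,\mathbf{R})$; each factorizes as $p(\mathbf{X}^\ast\mid\mathbf{X},\mathbf{R})\,p(\mathbf{X},\mathbf{R})$, where the first factor is the deterministic relation defining the proxies. Here $p$ denotes probability mass/density functions. The full law is $p(\mathbf{X},\mathbf{R})$, the target law is $p(\mathbf{X})$, and the observed data law is $p(\mathbf{X}^\ast,\mathbf{R})$. A nonparametric missing data model $\mathcal{M}_\Omega$ is a missing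 data model whose members share a description $\Omega$, i.e. a set of nonparametric assumptions (for example conditional independence restrictions, possibly encoded by a directed acyclic graph). Conditional independence statements $\perp$ are understood to hold in every member of $\mathcal{M}_\Omega$. Standing assumption (positivity): for every member, $p(\mathbf{X}=\mathbf{x},\mathbf{R}=\mathbf{r})>0$ for all value assignments $(\mathbf{x},\mathbf{r})$. Orderings. For an ordering $X_{(1)}\prec\cdots\prec X_{(n)}$, $\mathbf{X}_{\prec(i)}=\{X_{(j)}\in\mathbf{X}: X_{(j)}\prec X_{(i)}\}$, with $\mathbf{X}_{\prec(1)}=\emptyset$. Imputation method. An imputation method is a collection of stochastic kernels (imputation kernels), one for each missingness pattern $\mathbf{r}\in\{0,1\}^{|\mathbf{X}|}$ (a value of $\mathbf{R}$), giving a conditional distribution of the variables to be imputed given the retained observed variables, whose form is determined only by $\Omega$ and the observed data law $p(\mathbf{X}^\ast,\mathbf{R})$ (so the same functional of the observed data law is used for all members of $\mathcal{M}_\Omega$). Directly factorizable imputation. An imputation method is directly factorizable with respect to the ordering $X_{(1)}\prec\cdots\prec X_{(n)}$ if its imputation kernels are of the form $$\xi^{\mathrm{DF}}_{\mathbf{r}}(\mathbf{t}\mid\mathbf{h})=\prod_{j=m(\mathbf{r})}^n p(X_{(j)}\mid\mathbf{X}_{\prec(j)}),$$ where $m(\mathbf{r})$ is the index of the first variable in the ordering that is missing under $\mathbf{r}$, $\mathbf{H}(\mathbf{r})=\{X_{(j)}:j<m(\mathbf{r})\}$, $\mathbf{T}(\mathbf{r})=\{X_{(j)}:j\ge m(\mathbf{r})\}$,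 and $\mathbf{h}$, $\mathbf{t}$ are the values of $\mathbf{H}(\mathbf{r})$, $\mathbf{T}(\mathbf{r})$. (Thus all variables from the first missing one onward are imputed, even those observed; if nothing is missing under $\mathbf{r}$, nothing is imputed and the product is empty.) *)

(* Defs.v *)
From HB Require Import structures.
From mathcomp Require Import all_boot all_order all_algebra.
From mathcomp Require Import all_classical all_reals all_analysis.

Set Implicit Arguments.
Unset Strict Implicit.
Unset Printing Implicit Defensive.

Import Order.TTheory GRing.Theory Num.Theory.
Import numFieldNormedType.Exports.

Local Open Scope classical_set_scope.
Local Open Scope ring_scope.

(* Product of a family of measurable spaces, with the product sigma-algebra
   (the one generated by the coordinate maps).                               *)
Section product_space.
Context (I : Type) (d : I -> measure_display).
Variable T : forall i, measurableType (d i).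

Definition prod_space : Type := forall i, T i.

Definition prod_space_measurable : set (set prod_space) :=
  <<s \bigcup_i preimage_set_system setT (fun x : prod_space => x i)
        (@measurable _ (T i)) >>.

Let prod_space0 : prod_space_measurable set0.
Proof. exact: sigma_algebra0. Qed.

Let prod_spaceC A : prod_space_measurable A -> prod_space_measurable (~` A).
Proof. exact: sigma_algebraC. Qed.

Let prod_space_bigcup (F : (set prod_space)^nat) :
  (forall i, prod_space_measurable (F i)) ->
  prod_space_measurable (\bigcup_i F i).
Proof. exact: sigma_algebra_bigcup. Qed.

HB.instance Definition _ := gen_eqMixin prod_space.
HB.instance Definition _ := gen_choiceMixin prod_space.
HB.instance Definition _ :=
  isPointed.Build prod_space (fun i => point : T i).
HB.instance Definition _ := @isMeasurable.Build default_measure_display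
  prod_space prod_space_measurable prod_space0 prod_spaceC prod_space_bigcup.

End product_space.

(* The values of a proxy: [None] is NA, and a set of values is measurable when
   the non-missing values in it form a measurable set.                       *)
Section option_space.
Context (d : measure_display) (T : measurableType d).

Definition proxy_value : Type := option T.

Definition proxy_value_measurable : set (set proxy_value) :=
  [set A | measurable [set t : T | A (Some t)]].

Let proxy_value0 : proxy_value_measurable set0.
Proof. exact: measurable0. Qed.

Let proxy_valueC A :
  proxy_value_measurable A -> proxy_value_measurable (~` A).
Proof. exact: measurableC. Qed.

Let proxy_value_bigcup (F : (set proxy_value)^nat) :
  (forall i, proxy_value_measurable (F i)) ->
  proxy_value_measurable (\bigcup_i F i).
Proof. by move=> mF; exact: bigcupT_measurable. Qed.

HB.instance Definition _ := Choice.on proxy_value.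
HB.instance Definition _ := isPointed.Build proxy_value None.
HB.instance Definition _ := @isMeasurable.Build d
  proxy_value proxy_value_measurable proxy_value0 proxy_valueC
  proxy_value_bigcup.

End option_space.

(* A value of the vector of response indicators: [r v] is true when R_v = 1,
   i.e. when the variable v is observed.                                     *)
Section pattern.
Variable V : finType.

Definition pattern : Type := {ffun V -> bool}.

HB.instance Definition _ := Finite.on pattern.
HB.instance Definition _ := isPointed.Build pattern [ffun=> false].
HB.instance Definition _ := @isMeasurable.Build default_measure_display
  pattern discrete_measurable (@discrete_measurable0 _)
  (@discrete_measurableC _) (@discrete_measurableU _).

End pattern.

Section missing_data.
Context (R : realType) (V : finType) (d : V -> measure_display).
Variable T : forall v, measurableType (d v).
(* Densities are taken with respect to the sigma-finite measures [mu v]: for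
   instance a counting measure gives mass functions, the Lebesgue measure
   gives densities.                                                          *)
Variable mu : forall v, {sigma_finite_measure set (T v) -> \bar R}.

Definition Xspace := prod_space T.
Definition Xstar_space :=
  prod_space (fun v => proxy_value (T v) : measurableType (d v)).

Definition sub_space (A : {set V}) :=
  prod_space (fun v : {v : V | v \in A} => T (val v)).
Definition restrict_to (A : {set V}) (x : Xspace) : sub_space A :=
  fun v => x (val v).
Arguments restrict_to A x : clear implicits.

Definition proxy (x : Xspace) (r : pattern V) : Xstar_space :=
  fun v => if r v then Some (x v) else None.

(* Integral of [f] over the coordinates in [A], the other coordinates being
   those of [x]. By Tonelli's theorem the order of integration is irrelevant
   for the nonnegative measurable functions to which this is applied.        *)
Definition integral_over (A : {set V}) (f : Xspace -> \bar R) :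
    Xspace -> \bar R :=
  foldr (fun v (g : Xspace -> \bar R) (x : Xspace) =>
           (\int[mu v]_y g (dfwith x v y))%E) f (enum A).

(* A member of a missing data model, i.e. a joint distribution of (X, X*, R)
   together with (a version of) the density p(x, r) of the full law.         *)
Record missing_data_law := MissingDataLaw {
  joint_law : probability (Xspace * Xstar_space * pattern V)%type R;
  full_law : set (Xspace * pattern V) -> \bar R :=
    pushforward joint_law (fun w => (w.1.1, w.2));
  full_pdf : Xspace -> pattern V -> R;
  measurable_full_pdf : forall r, measurable_fun setT (full_pdf ^~ r);
  positivity : forall x r, 0 < full_pdf x r;
  full_lawE : forall (B : set Xspace) (r : pattern V), measurable B ->
    full_law (B `*` [set r]) =
    integral_over [set: V]%SET (fun x => (\1_B x * full_pdf x r)%:E) point;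
  (* p(X* | X, R) is the deterministic relation defining the proxies *)
  joint_lawE : forall C, measurable C ->
    joint_law C =
    pushforward full_law (fun z => (z.1, proxy z.1 z.2, z.2)) C
}.

Definition target_law (P : missing_data_law) : set Xspace -> \bar R :=
  pushforward (joint_law P) (fun w => w.1.1).

Definition observed_part (w : Xspace * Xstar_space * pattern V) :
  Xstar_space * pattern V := (w.1.2, w.2).

Lemma measurable_observed_part : measurable_fun setT observed_part.
Proof.
apply: measurable_fun_pair; last exact: measurable_snd.
exact: measurableT_comp measurable_snd measurable_fst.
Qed.

HB.instance Definition _ :=
  isMeasurableFun.Build _ _ _ _ observed_part measurable_observed_part.

Definition observed_law (P : missing_data_law) :
  probability (Xstar_space * pattern V)%type R :=
  distribution (joint_law P) observed_part.

(* p(x_A, r_B); as a function of x and r it depends only on the coordinates of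
   x in A and on those of r in B. The marginal integrals are finite almost
   everywhere, so that [fine] is harmless.                                   *)
Definition marginal_pdf (P : missing_data_law) (A B : {set V})
    (x : Xspace) (r : pattern V) : R :=
  fine (\sum_(r' : pattern V | [forall v in B, r' v == r v])
          integral_over (~: A) (fun y => (full_pdf P y r')%:E) x)%E.

(* p(x_A, r_B | x_C) *)
Definition conditional_pdf (P : missing_data_law) (A B C : {set V})
    (x : Xspace) (r : pattern V) : R :=
  marginal_pdf P (A :|: C) B x r / marginal_pdf P C finset.set0 x r.

Definition X_indep_R (P : missing_data_law) (A B : {set V}) : Prop :=
  \forall x \ae target_law P, forall r : pattern V,
    marginal_pdf P A B x r =
    marginal_pdf P A finset.set0 x r * marginal_pdf P finset.set0 B x r.

Definition X_indep_R_given (P : missing_data_law) (A B C : {set V}) : Prop :=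
  \forall x \ae target_law P, forall r : pattern V,
    conditional_pdf P A B C x r =
    conditional_pdf P A finset.set0 C x r *
    conditional_pdf P finset.set0 B C x r.

(* p(x_A | x_C), on which the pattern [point] has no bearing *)
Definition X_conditional_pdf (P : missing_data_law) (A C : {set V})
    (x : Xspace) : R :=
  conditional_pdf P A finset.set0 C x point.

(* A probability measure is a function on all sets, but as a law it is given
   by its values on measurable sets; [kernel_ext] makes the kernels functions
   of the law.                                                               *)
Record imputation_method := ImputationMethod {
  retained : pattern V -> {set V};
  retained_observed : forall (r : pattern V) v, v \in retained r -> r v;
  imputed : pattern V -> {set V} := fun r => ~: retained r;
  imputation_kernel :
    probability (Xstar_space * pattern V)%type R ->
    forall r, R.-pker sub_space (retained r) ~> sub_space (imputed r);
  kernel_ext : forall Q Q' : probability (Xstar_space * pattern V)%type R,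
    (forall C, measurable C -> Q C = Q' C) ->
    forall r h B, measurable B ->
      imputation_kernel Q r h B = imputation_kernel Q' r h B
}.

Section ordering.
Variables (n : nat) (s : 'I_n -> V).

Definition predecessors (j : 'I_n) : {set V} := (s @: [set i : 'I_n | (i < j)%N])%SET.

(* 0-based position of the first variable missing under r; n if there is none *)
Definition first_missing (r : pattern V) : nat :=
  find (fun j : 'I_n => ~~ r (s j)) (enum 'I_n).

Definition directly_factorizable (M : set missing_data_law)
    (K : imputation_method) : Prop :=
  (forall r,
     retained K r = (s @: [set j : 'I_n | (j < first_missing r)%N])%SET) /\
  forall P, M P -> forall r : pattern V,
    \forall x \ae target_law P,
      forall B : set (sub_space (imputed K r)), measurable B ->
        imputation_kernel K (observed_law P) r
          (restrict_to (retained K r) x) B =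
        integral_over (imputed K r) (fun y =>
          (\1_B (restrict_to (imputed K r) y) *
           \prod_(j < n | (first_missing r <= j)%N)
             X_conditional_pdf P [set s j]%SET (predecessors j) y)%:E) x.

End ordering.

End missing_data.

(* Main.v *)
Require Import Defs.
From HB Require Import structures.
From mathcomp Require Import all_boot all_order all_algebra.
From mathcomp Require Import finmap.
From mathcomp Require Import all_classical all_reals all_analysis.
From mathcomp Require Import measurable_realfun.

Set Implicit Arguments.
Unset Strict Implicit.
Unset Printing Implicit Defensive.

Import Order.TTheory GRing.Theory Num.Theory.

Local Open Scope classical_set_scope.
Local Open Scope ring_scope.

(** Write [X_<=j] for the first j+1 variables of the ordering and [X_<j] for the
    first j of them. The theorem holds because every factor of the kernel is a
    functional of the observed data law:
      p(x_j | x_<j) = p(x_<=j, R_<=j = 1) / p(x_<j, R_<=j = 1)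
    for almost every x. This is the independence hypothesis at the pattern in
    which everything is observed, after cancelling the positive and almost
    surely finite density p(x_<j) ([X_conditional_pdf_observed]). Numerator and
    denominator are densities on the event R_<=j = 1, where the proxies of
    X_<=j are the variables themselves; their integrals over sets of values of
    X_<=j are therefore probabilities of observed events, and two laws with the
    same observed data law have the same numerator and denominator almost
    everywhere ([marginal_identified]). Hence they have the same product of
    conditional densities ([imputation_density_identified]).

    The method attached to an observed law Q uses the product of conditional
    densities of some member of the model that induces Q; by the above, the
    choice matters only on a null set. The choice is made from the set of the
    products induced by Q, which depends only on the values of Q on measurable
    sets, so the kernels are a functional of the law ([eq_chosen_density]).

    A kernel must have total mass 1 at every value of the retained variables.
    The conditional densities telescope, their product over j >= m being
    p(x) / p(x_<m) almost everywhere ([imputation_density_telescope]), so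
    the mass is 1 at almost every value ([imputation_density_mass]). At the
    other values the mass is repaired by normalization, or by a Dirac measure
    where the mass is 0 or infinite; this changes nothing almost everywhere.

    All these facts concern iterated integrals over finitely many coordinates.
    To have the theorems of integration for them, the integral over the
    coordinates in A from a base point is shown to be integration against a
    measure on the whole space ([iterated_integral_measure]). Null sets are
    those of the product measure, because positive densities make every target
    law equivalent to it ([ae_target_law]). *)

(** * Positive functionals as measures *)

Section positive_functional.
Import HBNNSimple.
Local Open Scope ereal_scope.
Context (d : measure_display) (T : measurableType d) (R : realType).
Variable Phi : (T -> \bar R) -> \bar R.
Hypothesis Phi_ge0 : forall f, (forall x, 0 <= f x) -> 0 <= Phi f.
Hypothesis PhiD : forall f g : T -> \bar R,
  measurable_fun setT f -> (forall x, 0 <= f x) ->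
  measurable_fun setT g -> (forall x, 0 <= g x) ->
  Phi (fun x => f x + g x) = Phi f + Phi g.
Hypothesis PhiZ : forall (k : R) (f : T -> \bar R), (0 <= k)%R ->
  measurable_fun setT f -> (forall x, 0 <= f x) ->
  Phi (fun x => k%:E * f x) = k%:E * Phi f.
Hypothesis Phi_lim : forall f : (T -> \bar R)^nat,
  (forall n, measurable_fun setT (f n)) -> (forall n x, 0 <= f n x) ->
  (forall x, nondecreasing_seq (f ^~ x)) ->
  Phi (fun x => limn (f ^~ x)) = limn (Phi \o f).

Let Phi0 : Phi (cst 0) = 0.
Proof.
have := @PhiZ 0%R (cst 0) (lexx _) (measurable_cst _) (fun=> lexx _).
rewrite mul0e => h; rewrite -[RHS]h.
by congr Phi; apply/funext => x /=; rewrite mul0e.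
Qed.

Let Phi_sum (I : Type) (s : seq I) (f : I -> T -> \bar R) :
  (forall i, measurable_fun setT (f i)) -> (forall i x, 0 <= f i x) ->
  Phi (fun x => \sum_(i <- s) f i x) = \sum_(i <- s) Phi (f i).
Proof.
move=> mf f0; elim: s => [|i s ih].
  by rewrite big_nil -[RHS]Phi0; congr Phi; apply/funext => x; rewrite big_nil.
rewrite big_cons -ih// -PhiD//.
- by congr Phi; apply/funext => x; rewrite big_cons.
- exact: emeasurable_sum.
- by move=> x; exact: sume_ge0.
Qed.

Let m (B : set T) : \bar R := Phi (fun x => (\1_B x)%:E).

Let m0 : m set0 = 0.
Proof.
by rewrite -[RHS]Phi0; congr Phi; apply/funext => x; rewrite indic0.
Qed.

Let m_ge0 B : 0 <= m B.
Proof. by apply: Phi_ge0 => x; rewrite lee_fin. Qed.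

Let mind (B : set T) : measurable B ->
  measurable_fun setT (fun x => (\1_B x)%:E : \bar R).
Proof. by move=> mB; exact/measurable_EFinP. Qed.

Let m_sigma_additive : semi_sigma_additive m.
Proof.
move=> F mF tF mUF.
pose f n x : \bar R := \sum_(0 <= i < n) (\1_(F i) x)%:E.
have fE : (fun n => \sum_(0 <= i < n) m (F i)) = Phi \o f.
  by apply/funext => n; rewrite /= Phi_sum// => i _; exact: mind.
have mf n : measurable_fun setT (f n).
  by apply: emeasurable_sum => i; exact: mind.
have f0 n x : 0 <= f n x by apply: sume_ge0 => i _; rewrite lee_fin.
have ndf x : nondecreasing_seq (f ^~ x).
  by move=> a b ab; apply: lee_sum_nneg_natr => // k _ _; rewrite lee_fin.
(* Pointwise, additivity of indicators is that of the Dirac measure. *)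
have -> : m (\bigcup_n F n) = limn (Phi \o f).
  rewrite -Phi_lim//; congr Phi; apply/funext => x.
  rewrite -[LHS]/(\d_x (\bigcup_n F n)).
  by rewrite measure_semi_bigcup.
rewrite fE -fE; apply: is_cvg_ereal_nneg_natsum => i _; exact: m_ge0.
Qed.

HB.instance Definition _ := isMeasure.Build _ _ _ m m0 m_ge0 m_sigma_additive.

Let Phi_nnsfun (f : {nnsfun T >-> R}) :
  \int[m]_x (f x)%:E = Phi (fun x => (f x)%:E).
Proof.
rewrite integralT_nnsfun sintegralE.
have fin : finite_set (range f) by [].
rewrite fsbig_finite//=.
have r0 r : r \in fset_set (range f) -> (0 <= r)%R.
  by rewrite in_fset_set// => /set_mem [x _ <-].
have mi r : measurable_fun setT (fun x => (\1_(f @^-1` [set r]) x)%:E : \bar R).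
  exact: mind.
transitivity (Phi (fun x => \sum_(r <- fset_set (range f))
    (r%:E * (\1_(f @^-1` [set r]) x)%:E))); last first.
  congr Phi; apply/funext => x; rewrite [X in _ = X%:E]fimfunE fsbig_finite//=.
  by rewrite -sumEFin; apply: eq_bigr => r _; rewrite EFinM.
rewrite Phi_sum//.
- apply: eq_big_seq => r rf; rewrite PhiZ//; exact: r0.
- by move=> r; exact: measurable_funeM.
- by move=> r x; rewrite -EFinM nnfun_muleindic_ge0.
Qed.

(** A Daniell-type representation: the measure of a set is the value of the
    functional at its indicator. The hypotheses pass at once from an integral
    to an integral of integrals, so that iterated integrals can be represented
    without constructing products of measures. *)
Lemma positive_functional_integral : exists nu : {measure set T -> \bar R},
  forall f : T -> \bar R, measurable_fun setT f -> (forall x, 0 <= f x) ->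
    \int[nu]_x f x = Phi f.
Proof.
exists m => f mf f0.
pose g n := nnsfun_approx measurableT mf n.
have gf x : limn (fun n => (g n x)%:E) = f x.
  by apply/cvg_lim => //; exact: cvg_nnsfun_approx.
have mg n : measurable_fun setT (fun x => (g n x)%:E : \bar R).
  exact/measurable_EFinP.
have g0 n x : 0 <= (g n x)%:E by rewrite lee_fin.
have ndg x : nondecreasing_seq (fun n => (g n x)%:E : \bar R).
  by move=> a b ab; rewrite lee_fin; exact/lefP/nd_nnsfun_approx.
have -> : f = (fun x => limn (fun n => (g n x)%:E)).
  by apply/funext => x; rewrite gf.
rewrite Phi_lim//.
rewrite monotone_convergence//.
by congr (limn _); apply/funext => n; exact: Phi_nnsfun.
Qed.

End positive_functional.

(** * Iterated integrals on a product space *)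

Section product_space_measurability.
Context (I : eqType) (d : I -> measure_display).
Variable T : forall i, measurableType (d i).

Lemma measurable_coordinate (i : I) :
  measurable_fun setT (fun x : prod_space T => x i : T i).
Proof.
move=> _ B mB; apply: sub_sigma_algebra.
by exists i => //; exists B.
Qed.

Arguments measurable_coordinate : clear implicits.

Lemma measurable_to_prod_space (d' : measure_display) (Y : measurableType d')
    (f : Y -> prod_space T) :
  (forall i, measurable_fun setT (fun y => f y i : T i)) ->
  measurable_fun setT f.
Proof.
move=> mf.
apply: (@measurability _ _ _ _ _ _
  (\bigcup_i preimage_set_system setT (fun x : prod_space T => x i)
     (@measurable _ (T i)))) => //.
move=> _ [_ [i _ [B mB <-]] <-].
by rewrite !setTI; have := mf i measurableT _ mB; rewrite setTI.
Qed.

Lemma measurable_dfwith (i : I) :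
  measurable_fun setT
    (fun z : prod_space T * T i => dfwith z.1 i z.2 : prod_space T).
Proof.
apply: measurable_to_prod_space => j.
have [<-|ij] := eqVneq i j.
  rewrite (_ : (fun _ => _) = snd); first exact: measurable_snd.
  by apply/funext => z; rewrite dfwithin.
rewrite (_ : (fun _ => _) = (fun x : prod_space T => x j : T j) \o fst).
  exact: measurableT_comp (measurable_coordinate j) measurable_fst.
by apply/funext => z; rewrite /= dfwithout.
Qed.

End product_space_measurability.
Arguments measurable_coordinate {I d} T i.
Arguments measurable_dfwith {I d} T i.

Section iterated_integrals.
Context (R : realType) (V : finType) (d : V -> measure_display).
Variable T : forall v, measurableType (d v).
Variable mu : forall v, {sigma_finite_measure set (T v) -> \bar R}.
Local Open Scope ereal_scope.

Local Notation X := (Xspace T).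

Definition iterated_integral (s : seq V) (f : X -> \bar R) : X -> \bar R :=
  foldr (fun v (g : X -> \bar R) (x : X) =>
           (\int[mu v]_y g (dfwith x v y))%E) f s.

Definition nonneg_measurable (f : X -> \bar R) :=
  measurable_fun setT f /\ forall x, 0 <= f x.

Lemma measurable_section (v : V) (f : X -> \bar R) (x : X) :
  measurable_fun setT f ->
  measurable_fun setT (fun y : T v => f (dfwith x v y)).
Proof.
move=> mf.
exact: measurableT_comp (measurableT_comp mf (measurable_dfwith T v))
  (measurable_pair1 x).
Qed.

Lemma nonneg_measurable_iterated (s : seq V) (f : X -> \bar R) :
  nonneg_measurable f -> nonneg_measurable (iterated_integral s f).
Proof.
move=> f0; elim: s => [//|v s [mg g0]]; split => /= [|x];
  last exact: integral_ge0.
apply: (@measurable_fun_fubini_tonelli_F _ _ X (T v) R (mu v)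
  (fun z => iterated_integral s f (dfwith z.1 v z.2))) => //.
exact: measurableT_comp mg (measurable_dfwith T v).
Qed.

Lemma iterated_integralD (s : seq V) (f g : X -> \bar R) :
  nonneg_measurable f -> nonneg_measurable g ->
  iterated_integral s (fun x => f x + g x) =
  (fun x => iterated_integral s f x + iterated_integral s g x).
Proof.
move=> f0 g0; elim: s => [//|v s ih] /=; apply/funext => x; rewrite ih.
have [mf' f0'] := nonneg_measurable_iterated s f0.
have [mg' g0'] := nonneg_measurable_iterated s g0.
by rewrite ge0_integralD//; exact: measurable_section.
Qed.

Lemma iterated_integralZ (s : seq V) (k : R) (f : X -> \bar R) :
  (0 <= k)%R -> nonneg_measurable f ->
  iterated_integral s (fun x => k%:E * f x) =
  (fun x => k%:E * iterated_integral s f x).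
Proof.
move=> k0 f0; elim: s => [//|v s ih] /=; apply/funext => x; rewrite ih.
have [mf' f0'] := nonneg_measurable_iterated s f0.
by rewrite ge0_integralZl_EFin//; exact: measurable_section.
Qed.

(** Monotonicity and continuity along increasing sequences are proved together,
    because the monotone convergence theorem for the outermost integral needs
    the inner integrals to increase. *)
Lemma iterated_integral_lim (s : seq V) (f : (X -> \bar R)^nat) :
  (forall n, nonneg_measurable (f n)) ->
  (forall x, nondecreasing_seq (f ^~ x)) ->
  (forall x, nondecreasing_seq (fun n => iterated_integral s (f n) x)) /\
  iterated_integral s (fun x => limn (f ^~ x)) =
  (fun x => limn (fun n => iterated_integral s (f n) x)).
Proof.
move=> f0 ndf; elim: s => [//|v s [nds ih]] /=.
have mf' n := (nonneg_measurable_iterated s (f0 n)).1.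
have f0' n := (nonneg_measurable_iterated s (f0 n)).2.
split=> [x a b ab|].
  apply: ge0_le_integral => //.
  - exact: measurable_section.
  - exact: measurable_section.
  - by move=> y _; exact: nds.
apply/funext => x; rewrite ih monotone_convergence// => n.
exact: measurable_section.
Qed.

(** Makes the theorems of integration available for iterated integrals with a
    fixed base point. The measure lives on the whole product space, with
    the coordinates off [s] frozen at those of [x]. *)
Lemma iterated_integral_measure (s : seq V) (x : X) :
  exists nu : {measure set X -> \bar R}, forall f, nonneg_measurable f ->
    \int[nu]_y f y = iterated_integral s f x.
Proof.
have [] := @positive_functional_integral _ X R
  (fun f => iterated_integral s f x).
- by move=> f f0; elim: s x => [x|v s ih x] /=; [exact: f0|exact: integral_ge0].
- by move=> f g mf f0 mg g0; rewrite iterated_integralD.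
- by move=> k f k0 mf f0; rewrite iterated_integralZ.
- move=> f mf f0 ndf.
  have fn0 n : nonneg_measurable (f n) by split.
  by have [_ ->] := iterated_integral_lim s fn0 ndf.
- by move=> nu nuE; exists nu => f [mf f0]; exact: nuE.
Qed.

Lemma iterated_integral_swap (v w : V) (s : seq V) (f : X -> \bar R) :
  nonneg_measurable f ->
  iterated_integral (v :: w :: s) f = iterated_integral (w :: v :: s) f.
Proof.
move=> f0; apply/funext => x /=.
have [->//|vw] := eqVneq v w.
have [mg g0] := nonneg_measurable_iterated s f0.
set g := iterated_integral s f in mg g0 *.
have mh : measurable_fun setT
    (fun z : T v * T w => g (dfwith (dfwith x v z.1) w z.2)).
  have m1 : measurable_fun setT
      (fun z : T v * T w => (dfwith x v z.1, z.2) : X * T w).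
    apply: measurable_fun_pair; last exact: measurable_snd.
    have mx : measurable_fun setT (fun y : T v => dfwith x v y : X).
      exact: measurableT_comp (measurable_dfwith T v) (measurable_pair1 x).
    exact: measurableT_comp mx measurable_fst.
  exact: measurableT_comp (measurableT_comp mg (measurable_dfwith T w)) m1.
rewrite (fubini_tonelli _ mh)//.
apply: eq_integral => z _; apply: eq_integral => y _.
congr g; apply: functional_extensionality_dep => u.
have [<-|vu] := eqVneq v u.
  by rewrite dfwithin dfwithout 1?eq_sym// dfwithin.
have [<-|wu] := eqVneq w u.
  by rewrite dfwithin dfwithout// dfwithin.
by rewrite !dfwithout.
Qed.

End iterated_integrals.

(** * Integration over sets of coordinates *)

Section integral_over_theory.
Context (R : realType) (V : finType) (d : V -> measure_display).
Variable T : forall v, measurableType (d v).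
Variable mu : forall v, {sigma_finite_measure set (T v) -> \bar R}.
Local Open Scope ereal_scope.

Local Notation X := (Xspace T).
Local Notation I_ := (integral_over mu).
Implicit Types (f g : X -> \bar R) (A B : {set V}) (N : set X).

Lemma iterated_integral_cat (s s' : seq V) f :
  iterated_integral mu (s ++ s') f =
  iterated_integral mu s (iterated_integral mu s' f).
Proof. by rewrite /iterated_integral foldr_cat. Qed.

Lemma iterated_integral_perm (s s' : seq V) f : nonneg_measurable f ->
  perm_eq s s' -> iterated_integral mu s f = iterated_integral mu s' f.
Proof.
move=> f0; elim: s s' => [s'|v s ih s'].
  by rewrite perm_sym => /perm_nilP ->.
move=> ss'; have vs' : v \in s' by rewrite -(perm_mem ss') mem_head.
case/splitPr: vs' ss' => s1 s2 ss'.
have {}ss' : perm_eq s (s1 ++ s2).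
  by rewrite -(perm_cons v) (perm_trans ss')//;
    exact/permPl/(perm_catCA s1 [:: v] s2).
have -> : iterated_integral mu (s1 ++ v :: s2) f =
          iterated_integral mu (v :: s1 ++ s2) f.
  elim: s1 {ss'} => [//|w s1 ih1].
  rewrite cat_cons [LHS]/= -/(iterated_integral mu _ f) ih1.
  exact: (iterated_integral_swap mu w v (s1 ++ s2) f0).
by rewrite /= -!/(iterated_integral mu _ f) (ih _ ss').
Qed.

(** Tonelli: the coordinates may be integrated in any order, in particular those
    of [B] first. *)
Lemma integral_over_setU A B f : nonneg_measurable f ->
  [disjoint A & B]%B -> I_ (A :|: B)%SET f = I_ A (I_ B f).
Proof.
move=> f0 AB.
rewrite -[RHS]/(iterated_integral mu (enum A)
  (iterated_integral mu (enum B) f)).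
rewrite -iterated_integral_cat; apply: iterated_integral_perm => //.
apply: uniq_perm; first exact: enum_uniq.
  rewrite cat_uniq !enum_uniq andbT/=; apply/hasPn => v /=.
  by rewrite !mem_enum => vB; rewrite (disjointFl AB).
by move=> v; rewrite mem_cat !mem_enum inE.
Qed.

Lemma integral_over_setC A f : nonneg_measurable f ->
  I_ [set: V]%SET f = I_ A (I_ (~: A)%SET f).
Proof.
move=> f0; rewrite -integral_over_setU ?finset.setUCr//.
by rewrite -finset.setI_eq0 finset.setICr.
Qed.

Lemma integral_over_set0 f : I_ finset.set0 f = f.
Proof. by rewrite /integral_over enum_set0. Qed.

Lemma nonneg_measurable_integral_over A f :
  nonneg_measurable f -> nonneg_measurable (I_ A f).
Proof. exact: nonneg_measurable_iterated. Qed.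

Lemma nonneg_measurable_indic N : measurable N ->
  nonneg_measurable (fun x => (\1_N x)%:E : \bar R).
Proof.
by move=> mN; split => [|x]; [exact/measurable_EFinP|rewrite lee_fin].
Qed.

Lemma integral_over_cst0 A : I_ A (cst 0) = cst 0.
Proof.
rewrite -[LHS]/(iterated_integral mu (enum A) _).
elim: (enum A) => [//|v s ih]; apply/funext => x /=.
by rewrite -/(iterated_integral mu s _) ih integral0.
Qed.

Lemma integral_over_sum (J : Type) (s : seq J) (P : pred J) A
    (f : J -> X -> \bar R) : (forall j, nonneg_measurable (f j)) ->
  I_ A (fun x => \sum_(j <- s | P j) f j x) =
  fun x => \sum_(j <- s | P j) I_ A (f j) x.
Proof.
move=> f0; elim: s => [|j s ih].
  rewrite (_ : (fun _ => _) = cst 0) ?integral_over_cst0.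
    by apply/funext => x; rewrite big_nil.
  by apply/funext => x; rewrite big_nil.
have s0 : nonneg_measurable (fun x => \sum_(j <- s | P j) f j x).
  split=> [|x]; last by apply: sume_ge0 => k _; exact: (f0 k).2.
  under eq_fun do rewrite big_mkcond.
  by apply: emeasurable_sum => k; case: (P k) => //; exact: (f0 k).1.
case Pj : (P j); last first.
  under eq_fun do rewrite big_cons Pj.
  by rewrite ih; apply/funext => x; rewrite big_cons Pj.
under eq_fun do rewrite big_cons Pj.
rewrite -[LHS]/(iterated_integral mu (enum A) _) iterated_integralD//.
apply/funext => x; rewrite big_cons Pj; congr (_ + _).
exact: (congr1 (@^~ x) ih).
Qed.

(** Stands for being a function of the coordinates in [A] only: marginal
    densities are functions on the whole space, and this avoids transporting
    them to a product over [A]. *)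
Definition depends_on (U : Type) A (f : X -> U) :=
  forall x y, (forall v, v \in A -> x v = y v) -> f x = f y.

Lemma depends_on_iterated (s : seq V) A f :
  depends_on A f ->
  depends_on (A :\: [set v in s])%SET (iterated_integral mu s f).
Proof.
move=> Af; elim: s => [|v s ih] x x' xx' /=.
  by apply: Af => v vA; apply: xx'; rewrite !inE vA.
apply: eq_integral => y _; apply: ih => u; rewrite !inE => /andP[us uA].
have [<-|vu] := eqVneq v u; first by rewrite !dfwithin.
by rewrite !dfwithout//; apply: xx'; rewrite !inE negb_or us uA eq_sym vu.
Qed.

Lemma depends_on_integral_over A B f :
  depends_on B f -> depends_on (B :\: A)%SET (I_ A f).
Proof.
move=> Bf x y xy; apply: (@depends_on_iterated (enum A) B) => // v.
by rewrite !inE mem_enum => vBA; apply: xy; rewrite inE.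
Qed.

Lemma depends_on_setT (U : Type) (f : X -> U) : depends_on [set: V]%SET f.
Proof.
move=> x y xy; congr f; apply: functional_extensionality_dep => v.
by apply: xy; rewrite inE.
Qed.

Lemma integral_over_mull A B f g :
  nonneg_measurable f -> (forall x, 0 <= g x) ->
  depends_on B g -> [disjoint A & B]%B ->
  I_ A (fun x => g x * f x) = fun x => g x * I_ A f x.
Proof.
move=> f0 g0 Bg AB; rewrite -[I_ A f]/(iterated_integral mu (enum A) f).
rewrite -[LHS]/(iterated_integral mu (enum A) _).
have : forall v, v \in enum A -> v \notin B.
  by move=> v; rewrite mem_enum => vA; rewrite (disjointFr AB).
elim: (enum A) => [//|v s ih] sB /=; apply/funext => x.
rewrite -!/(iterated_integral mu _ _) ih; last first.
  by move=> w ws; apply: sB; rewrite inE ws orbT.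
have [mf' f0'] := nonneg_measurable_iterated mu s f0.
rewrite -ge0_integralZl//; last exact: measurable_section.
apply: eq_integral => y _; congr (_ * _).
apply: Bg => u uB; rewrite dfwithout//.
by apply: contraTneq uB => <-; apply: sB; exact: mem_head.
Qed.

Definition over_measure A (x : X) : {measure set X -> \bar R} :=
  sval (cid (iterated_integral_measure mu (enum A) x)).

Lemma integral_over_measure A x f : nonneg_measurable f ->
  \int[over_measure A x]_y f y = I_ A f x.
Proof. by move=> f0; rewrite /over_measure; case: cid => m /= ->. Qed.

Lemma over_measureE A x N : measurable N ->
  over_measure A x N = I_ A (fun y => (\1_N y)%:E) x.
Proof.
move=> mN; rewrite -integral_over_measure; last exact: nonneg_measurable_indic.
by rewrite integral_indic// setIT.
Qed.

(** The product of all the reference measures: every coordinate is integrated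
    out, whatever the base point. *)
Definition product_law : {measure set X -> \bar R} :=
  over_measure [set: V]%SET point.

Lemma depends_on_indic A N :
  depends_on A N -> depends_on A (fun x => (\1_N x)%:E : \bar R).
Proof.
move=> AN x y /AN xy; rewrite !indicE (_ : (x \in N) = (y \in N))//.
by apply/idP/idP => /set_mem h; apply/mem_set; rewrite ?xy// -xy.
Qed.

(** The inner integral of the indicator of [N] over [A] is constant, because
    [N] depends on no other coordinate, so it vanishes everywhere. *)
Lemma null_of_depends_on A N : measurable N -> depends_on A N ->
  over_measure A point N = 0 -> product_law N = 0.
Proof.
move=> mN AN; rewrite !over_measureE// => N0.
have f0 := nonneg_measurable_indic mN.
rewrite (integral_over_setC (~: A)%SET)// finset.setCK.
have -> : I_ A (fun y => (\1_N y)%:E) = cst 0.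
  apply/funext => x; rewrite -[RHS]N0.
  apply: (depends_on_integral_over (A := A) (depends_on_indic AN)) => v.
  by rewrite finset.setDv inE.
by rewrite integral_over_cst0.
Qed.

(** The projection onto the coordinates in [A], completed by the base point used
    for integrals over [A]; it turns any set into one that depends on [A] only
    and has the same measure. *)
Definition truncate A (x : X) : X := fun v => if v \in A then x v else point.

Lemma measurable_truncate A : measurable_fun setT (truncate A).
Proof.
apply: measurable_to_prod_space => v; rewrite /truncate.
case: (v \in A); last exact: measurable_cst.
exact: measurable_coordinate.
Qed.

Lemma depends_on_truncate (U : Type) A (f : X -> U) :
  depends_on A (f \o truncate A).
Proof.
move=> x y xy; congr f; apply: functional_extensionality_dep => v.
by rewrite /truncate; case: ifPn => // /xy.
Qed.

Lemma depends_onE (U : Type) A (f : X -> U) :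
  depends_on A f -> f \o truncate A = f.
Proof.
by move=> Af; apply/funext => x; apply: Af => v vA; rewrite /truncate vA.
Qed.

Lemma eq_iterated_integral (s : seq V) f g x :
  (forall y, (forall v, v \notin s -> y v = x v) -> f y = g y) ->
  iterated_integral mu s f x = iterated_integral mu s g x.
Proof.
elim: s x => [|v s ih] x fg /=; first exact: fg.
apply: eq_integral => y _; apply: ih => z zx; apply: fg => u.
by rewrite inE negb_or => /andP[uv us]; rewrite zx// dfwithout// eq_sym.
Qed.

Lemma integral_over_truncate A f :
  I_ A (f \o truncate A) point = I_ A f point.
Proof.
apply: eq_iterated_integral => y yp; congr f.
apply: functional_extensionality_dep => v; rewrite /truncate.
by case: ifPn => // vA; rewrite yp// mem_enum.
Qed.

(** The exceptional set of the hypothesis need not depend on [A] only; its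
    preimage by the truncation does. *)
Lemma ae_of_depends_on A (Q : X -> Prop) : depends_on A Q ->
  {ae over_measure A point, forall x, Q x} -> {ae product_law, forall x, Q x}.
Proof.
move=> AQ [N [mN N0 QN]]; exists (truncate A @^-1` N).
have mN' : measurable (truncate A @^-1` N).
  by rewrite -[X in measurable X]setTI; exact: measurable_truncate.
split => //.
  apply: (@null_of_depends_on A) => //; first exact: depends_on_truncate.
  rewrite over_measureE// -N0 over_measureE// -[RHS]integral_over_truncate.
  by congr (I_ A _ point); apply/funext => x; rewrite /= !indicE.
move=> x /= Qx; apply: QN => /=.
by rewrite -[Q _]/((Q \o truncate A) x) depends_onE.
Qed.

Lemma ae_eq0_of_integral A f x : nonneg_measurable f -> I_ A f x = 0 ->
  {ae over_measure A x, forall y, f y = 0}.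
Proof.
move=> f0; rewrite -integral_over_measure// => h.
have : ae_eq (over_measure A x) setT f (cst 0).
  apply/ae_eq_integral_abs => //; first exact: f0.1.
  rewrite -[RHS]h; apply: eq_integral => y _.
  by rewrite gee0_abs//; exact: f0.2.
by apply: filterS => y; exact.
Qed.

(** Tonelli: the measure of the exceptional set is the integral of the measures
    of its sections, and these depend on the coordinates off [A] only. *)
Lemma ae_slice A (Q : X -> Prop) : {ae product_law, forall x, Q x} ->
  {ae product_law, forall x, {ae over_measure A x, forall y, Q y}}.
Proof.
move=> [N [mN N0 QN]].
have f0 := nonneg_measurable_indic mN.
have g0 := nonneg_measurable_integral_over A f0.
have : {ae product_law, forall x, I_ A (fun y => (\1_N y)%:E) x = 0}.
  apply: (@ae_of_depends_on (~: A)%SET).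
    move=> x y xy; congr (_ = _).
    apply: (depends_on_integral_over (A := A) (@depends_on_setT _ _)) => v.
    by rewrite !inE andbT => vA; apply: xy; rewrite inE.
  apply: ae_eq0_of_integral => //.
  rewrite -[X in I_ _ (I_ X _)]finset.setCK -integral_over_setC//.
  by rewrite -over_measureE.
by apply: filterS => x Ix0; exists N; split => //; rewrite over_measureE.
Qed.

Lemma ae_fin_of_integral A f : nonneg_measurable f -> depends_on A f ->
  I_ A f point < +oo -> {ae product_law, forall x, f x \is a fin_num}.
Proof.
move=> f0 Af fin; apply: (@ae_of_depends_on A).
  by move=> x y xy; rewrite (Af _ _ xy).
have : (over_measure A point).-integrable setT f.
  apply/integrableP; split; first exact: f0.1.
  rewrite (_ : \int[_]_(x in _) _ = I_ A f point)//.
  rewrite -integral_over_measure//; apply: eq_integral => x _.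
  by rewrite gee0_abs//; exact: f0.2.
by move=> /(integrable_ae measurableT); apply: filterS => x; exact.
Qed.

Lemma nonneg_measurable_indicM N f : measurable N -> nonneg_measurable f ->
  nonneg_measurable (fun x => (\1_N x)%:E * f x).
Proof.
move=> mN [mf f0]; split => [|x]; last by rewrite mule_ge0// lee_fin.
by apply: emeasurable_funM => //; exact/measurable_EFinP.
Qed.

(** Uniqueness of densities. Testing on sets [N] that depend on [A] only is
    enough: truncation replaces an arbitrary set by such a set. *)
Lemma ae_eq_of_integral A f g :
  nonneg_measurable f -> nonneg_measurable g ->
  depends_on A f -> depends_on A g -> I_ A f point < +oo ->
  (forall N, measurable N -> depends_on A N ->
    I_ A (fun x => (\1_N x)%:E * f x) point =
    I_ A (fun x => (\1_N x)%:E * g x) point) ->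
  {ae product_law, forall x, f x = g x}.
Proof.
move=> f0 g0 Af Ag fin fg; apply: (@ae_of_depends_on A).
  by move=> x y xy; rewrite (Af _ _ xy) (Ag _ _ xy).
have if_ : (over_measure A point).-integrable setT f.
  apply/integrableP; split; first exact: f0.1.
  rewrite (_ : \int[_]_(x in _) _ = I_ A f point)//.
  rewrite -integral_over_measure//; apply: eq_integral => x _.
  by rewrite gee0_abs//; exact: f0.2.
have intE h N : measurable N -> nonneg_measurable h -> depends_on A h ->
    \int[over_measure A point]_(x in N) h x =
    I_ A (fun x => (\1_(truncate A @^-1` N) x)%:E * h x) point.
  move=> mN h0 Ah; rewrite integral_mkcond epatch_indic.
  under eq_integral do rewrite /= muleC.
  rewrite integral_over_measure; last exact: nonneg_measurable_indicM.
  rewrite -integral_over_truncate; congr (I_ A _ point); apply/funext => x /=.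
  by rewrite -[in RHS](depends_onE Ah) /= !indicE.
have := integral_ae_eq measurableT if_ g0.1.
case=> [N _ mN|M [mM M0 QM]].
  rewrite !intE//; apply: fg; last exact: depends_on_truncate.
  by rewrite -[X in measurable X]setTI; exact: measurable_truncate.
by exists M; split => // x /= fgx; apply: QM => /= /(_ I).
Qed.

End integral_over_theory.

(** * Marginal densities and the observed data law *)

Section marginal_densities.
Context (R : realType) (V : finType) (d : V -> measure_display).
Variable T : forall v, measurableType (d v).
Variable mu : forall v, {sigma_finite_measure set (T v) -> \bar R}.
Local Open Scope ereal_scope.

Local Notation X := (Xspace T).
Local Notation I_ := (integral_over mu).
Implicit Types (P : missing_data_law mu) (A B : {set V}) (S : set X).
Implicit Types (E : pred (pattern V)) (r : pattern V).

Definition density P r (x : X) : \bar R := (full_pdf P x r)%:E.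

Lemma nonneg_measurable_density P r : nonneg_measurable (density P r).
Proof.
split => [|x]; last by rewrite lee_fin ltW// positivity.
by apply/measurable_EFinP; exact: measurable_full_pdf.
Qed.

Definition event S E : set (X * Xstar_space T * pattern V) :=
  [set w | S w.1.1 /\ E w.2].

Lemma measurable_event S E : measurable S -> measurable (event S E).
Proof.
move=> mS; rewrite (_ : event S E =
  (fst \o fst) @^-1` S `&` snd @^-1` [set r | E r])//.
apply: measurableI; rewrite -[X in measurable X]setTI.
  exact: (measurableT_comp measurable_fst measurable_fst).
exact: measurable_snd.
Qed.

Lemma joint_law_event P S E : measurable S ->
  joint_law P (event S E) =
  \sum_(r | E r) I_ [set: V]%SET (fun x => (\1_S x)%:E * density P r x) point.
Proof.
move=> mS.
transitivity (\sum_(r | E r) joint_law P (event S (pred1 r))); last first.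
  apply: eq_bigr => r _.
  rewrite -[RHS]/(I_ [set: V]%SET
    (fun x => (\1_S x * full_pdf P x r)%:E) point).
  rewrite -full_lawE//; congr (joint_law P _).
  by apply/seteqP; split => w /= [Sw /eqP wr]; split => //; exact/eqP.
rewrite (_ : event S E =
  event S [pred r | r \in [seq r <- index_enum _ | E r]]).
  rewrite -big_filter.
  elim: [seq _ <- _ | _] (filter_uniq E (index_enum_uniq (pattern V))).
    move=> _; rewrite big_nil (_ : event _ _ = set0) ?measure0//.
    by apply/seteqP; split => w // [].
  move=> r s ih /= /andP[rs us]; rewrite big_cons -ih// -measureU//.
  - congr (joint_law P _); apply/seteqP; split => w /=.
      by move=> [Sw]; rewrite inE => /orP[] ?; [left|right].
    by move=> [[Sw /= wr]|[Sw /= ws]]; split => //=; rewrite inE ?wr// ws orbT.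
  - exact: measurable_event.
  - exact: measurable_event.
  - apply/seteqP; split => w // [[_ /= /eqP wr] [_ /=]].
    by rewrite wr; exact/negP.
apply/seteqP; split => w [Sw /=]; rewrite ?mem_filter ?mem_index_enum ?andbT;
by split => //=; rewrite ?mem_filter ?mem_index_enum ?andbT.
Qed.

Lemma joint_law_proxy P C : measurable C -> joint_law P C =
  joint_law P [set w | C (w.1.1, proxy w.1.1 w.2, w.2)].
Proof. by move=> /joint_lawE ->. Qed.

Definition impute_point (z : Xstar_space T) : X := fun v => odflt point (z v).

Lemma measurable_impute_point : measurable_fun setT impute_point.
Proof.
apply: measurable_to_prod_space => v.
have mo : measurable_fun setT (odflt point : proxy_value (T v) -> T v).
  by move=> _ B mB; rewrite setTI.
exact: measurableT_comp mo (measurable_coordinate _ v).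
Qed.

Lemma impute_point_proxy A S E (x : X) r : depends_on A S ->
  (forall r, E r -> forall v, v \in A -> r v) -> E r ->
  S (impute_point (proxy x r)) = S x.
Proof.
move=> AS EA Er; apply: AS => v vA.
by rewrite /impute_point /proxy (EA _ Er).
Qed.

Definition observed_event S E : set (Xstar_space T * pattern V) :=
  [set o | S (impute_point o.1) /\ E o.2].

Lemma measurable_observed_event S E : measurable S ->
  measurable (observed_event S E).
Proof.
move=> mS; rewrite (_ : observed_event S E =
  (impute_point \o fst) @^-1` S `&` snd @^-1` [set r | E r])//.
apply: measurableI; rewrite -[X in measurable X]setTI.
  exact: (measurableT_comp measurable_impute_point measurable_fst).
exact: measurable_snd.
Qed.

(** When the variables in [A] are observed on [E], the proxies determine whether
    a set that depends on [A] only contains the vector of variables; the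
    observed law then gives the joint law of that set and [E]. *)
Lemma observed_law_event P A S E : measurable S -> depends_on A S ->
  (forall r, E r -> forall v, v \in A -> r v) ->
  observed_law P (observed_event S E) = joint_law P (event S E).
Proof.
move=> mS AS EA.
rewrite -[LHS]/(joint_law P (@observed_part _ _ _ @^-1` observed_event S E)).
rewrite joint_law_proxy.
  congr (joint_law P _); apply/seteqP; split => w /= [Sw Ew]; split => //;
  by move: Sw; rewrite /= (impute_point_proxy _ AS EA Ew).
rewrite -[X in measurable X]setTI.
by apply: measurable_observed_part => //; exact: measurable_observed_event.
Qed.

(** The density p(x_A, R in E) before it is made real-valued, for an arbitrary
    set [E] of patterns. *)
Definition marginal P E A (x : X) : \bar R :=
  \sum_(r | E r) I_ (~: A)%SET (density P r) x.

Lemma nonneg_measurable_marginal P E A : nonneg_measurable (marginal P E A).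
Proof.
have h r := nonneg_measurable_integral_over mu (~: A)%SET
  (nonneg_measurable_density P r).
split => [|x]; last by apply: sume_ge0 => r _; exact: (h r).2.
rewrite /marginal; under eq_fun do rewrite big_mkcond.
by apply: emeasurable_sum => r; case: (E r) => //; exact: (h r).1.
Qed.

Lemma depends_on_marginal P E A : depends_on A (marginal P E A).
Proof.
move=> x y xy; apply: eq_bigr => r _.
apply: (depends_on_integral_over mu (A := (~: A)%SET)
  (@depends_on_setT _ _ _ _ (density P r))) => v.
by rewrite !inE negbK andbT; exact: xy.
Qed.

Lemma integral_marginal P E A S : measurable S -> depends_on A S ->
  I_ A (fun x => (\1_S x)%:E * marginal P E A x) point =
  joint_law P (event S E).
Proof.
move=> mS AS; rewrite joint_law_event//.
have h r := nonneg_measurable_density P r.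
have hS r := nonneg_measurable_indicM mS (h r).
have S0 x : 0 <= (\1_S x)%:E :> \bar R by rewrite lee_fin.
have AC : [disjoint (~: A)%SET & A]%B.
  by rewrite -finset.setI_eq0 finset.setIC finset.setICr.
transitivity (I_ A (fun x => \sum_(r | E r)
    I_ (~: A)%SET (fun x => (\1_S x)%:E * density P r x) x) point).
  congr (I_ A _ point); apply/funext => x; rewrite /marginal ge0_sume_distrr.
    apply: eq_bigr => r _.
    by rewrite (integral_over_mull _ (h r) S0 (depends_on_indic R AS) AC).
  by move=> r _; exact: (nonneg_measurable_integral_over mu _ (h r)).2.
rewrite integral_over_sum; last first.
  by move=> r; exact: nonneg_measurable_integral_over.
by apply: eq_bigr => r _; rewrite -integral_over_setC.
Qed.

Lemma joint_law_lt_pinfty P C : measurable C -> joint_law P C < +oo.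
Proof. by move=> mC; rewrite (le_lt_trans (probability_le1 _ mC))// ltry. Qed.

Lemma integral_marginalT P E A :
  I_ A (marginal P E A) point = joint_law P (event setT E).
Proof.
rewrite -(@integral_marginal P E A)//; congr (I_ A _ point).
by apply/funext => x; rewrite indicT mul1e.
Qed.

Lemma marginal_fin_num P E A :
  {ae product_law mu, forall x, marginal P E A x \is a fin_num}.
Proof.
apply: (@ae_fin_of_integral _ _ _ _ _ A).
  exact: nonneg_measurable_marginal.
  exact: depends_on_marginal.
by rewrite integral_marginalT joint_law_lt_pinfty//; exact: measurable_event.
Qed.

Lemma product_law_null P r S : measurable S ->
  I_ [set: V]%SET (fun x => (\1_S x)%:E * density P r x) point = 0 ->
  product_law mu S = 0.
Proof.
move=> mS /(ae_eq0_of_integral (nonneg_measurable_indicM mS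
  (nonneg_measurable_density P r)))[N [mN N0 SN]].
apply: (subset_measure0 mS mN _ N0) => x Sx; apply: SN => /=.
rewrite indicE mem_set// mul1e => /eqP.
by rewrite eqe gt_eqF// positivity.
Qed.

Lemma sum_ge0_eq0 (J : finType) (Q : pred J) (f : J -> \bar R) j :
  (forall k, 0 <= f k) -> Q j -> \sum_(k | Q k) f k = 0 -> f j = 0.
Proof.
move=> f0 Qj; rewrite (bigD1 j)//= => /eqP.
rewrite padde_eq0//; last by apply: sume_ge0 => k _; exact: f0.
by move=> /andP[/eqP].
Qed.

Lemma joint_law_eq0 P S E r : measurable S -> E r ->
  joint_law P (event S E) = 0 -> product_law mu S = 0.
Proof.
move=> mS Er; rewrite joint_law_event// => /(sum_ge0_eq0 _ Er) h.
apply: (product_law_null (P := P) (r := r)) => //; apply: h => k.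
apply: (nonneg_measurable_integral_over mu _ _).2.
by apply: nonneg_measurable_indicM => //; exact: nonneg_measurable_density.
Qed.

(** Where the marginal vanishes, its integral is 0, so the event has probability
    0 jointly with [E]; by positivity of the density of a pattern in [E] it is
    then null. *)
Lemma marginal_gt0 P E A r : E r ->
  {ae product_law mu, forall x, 0 < marginal P E A x}.
Proof.
move=> Er; have [mm m0] := nonneg_measurable_marginal P E A.
pose S : set X := [set x | marginal P E A x = 0].
have mS : measurable S.
  rewrite (_ : S = ~` [set x | marginal P E A x != 0]).
    apply: measurableC; rewrite -[X in measurable X]setTI.
    exact: (emeasurable_neq measurableT mm 0).
  apply/seteqP; split => x /=; first by move=> ->; rewrite eqxx.
  by move=> /negP; rewrite negbK => /eqP.
exists S; split => //; last first.
  move=> x /= /negP; rewrite -leNgt => mle; apply/eqP.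
  by rewrite eq_le mle m0.
apply: (@joint_law_eq0 P S E r) => //.
rewrite -(@integral_marginal P E A)//; last first.
  by move=> x y xy; congr (_ = _); exact: depends_on_marginal.
rewrite (_ : (fun x => _) = cst 0) ?integral_over_cst0//.
apply/funext => x /=; rewrite indicE.
case: (boolP (x \in S)) => [/set_mem Sx|_].
  by rewrite (Sx : marginal P E A x = 0) mule0.
by rewrite mul0e.
Qed.

(** Positivity makes the target law and the product of the reference measures
    have the same null sets. In particular, all members of the model have the
    same null sets. *)
Lemma ae_target_law P (Q : X -> Prop) :
  {ae target_law P, forall x, Q x} <-> {ae product_law mu, forall x, Q x}.
Proof.
have tE S : target_law P S = joint_law P (event S predT).
  by congr (joint_law P _); apply/seteqP; split => w /=; [|case].
split => -[N [mN N0 QN]]; exists N; split => //.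
  by apply: (@joint_law_eq0 P N predT point) => //; rewrite -tE.
rewrite tE joint_law_event// big1// => r _.
rewrite -integral_over_measure; last first.
  by apply: nonneg_measurable_indicM => //; exact: nonneg_measurable_density.
transitivity (\int[product_law mu]_(x in N) density P r x).
  rewrite [RHS]integral_mkcond epatch_indic.
  by apply: eq_integral => x _ /=; rewrite muleC.
apply: null_set_integral => //.
exact: measurable_funTS (nonneg_measurable_density P r).1.
Qed.

(** Both functions are densities, with respect to the coordinates in [A], of the
    probability of the same observed events. *)
Lemma marginal_identified P P' E A :
  (forall C, measurable C -> observed_law P C = observed_law P' C) ->
  (forall r, E r -> forall v, v \in A -> r v) ->
  {ae product_law mu, forall x, marginal P E A x = marginal P' E A x}.
Proof.
move=> PP' EA.
apply: (@ae_eq_of_integral _ _ _ _ _ A).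
- exact: nonneg_measurable_marginal.
- exact: nonneg_measurable_marginal.
- exact: depends_on_marginal.
- exact: depends_on_marginal.
- by rewrite integral_marginalT joint_law_lt_pinfty//; exact: measurable_event.
- move=> S mS AS; rewrite !integral_marginal//.
  rewrite -!(observed_law_event _ mS AS EA) PP'//.
  exact: measurable_observed_event.
Qed.

End marginal_densities.

(** * Identification of the conditional densities *)

Section conditional_densities.
Context (R : realType) (V : finType) (d : V -> measure_display).
Variable T : forall v, measurableType (d v).
Variable mu : forall v, {sigma_finite_measure set (T v) -> \bar R}.
Variables (n : nat) (s : 'I_n -> V).

Local Notation X := (Xspace T).
Local Notation I_ := (integral_over mu).
Implicit Types (P : missing_data_law mu) (A B : {set V}) (j : 'I_n).

(** [initial j] is convertible to [predecessors s j]; here the bound may also be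
    the number of variables. *)
Definition initial (k : nat) : {set V} := (s @: [set i : 'I_n | (i < k)%N])%SET.

Lemma initial0 : initial 0 = finset.set0.
Proof.
by apply/finset.setP => v; rewrite inE; apply/imsetP => -[i]; rewrite inE.
Qed.

Lemma initialS j : (s j |: initial j)%SET = initial j.+1.
Proof.
apply/finset.setP => v; rewrite !inE; apply/orP/imsetP.
  move=> [/eqP ->|/imsetP[i]]; first by exists j; rewrite ?inE.
  by rewrite inE => ij ->; exists i => //; rewrite inE ltnW.
move=> [i]; rewrite inE ltnS leq_eqVlt => /orP[/eqP/val_inj ->|ij] ->.
  by left.
by right; apply/imsetP; exists i; rewrite ?inE.
Qed.

Lemma initial_full : bijective s -> initial n = [set: V]%SET.
Proof.
move=> [t st ts]; apply/finset.setP => v; rewrite inE; apply/imsetP.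
by exists (t v); rewrite ?inE ?ts.
Qed.

Definition target_marginal P k (x : X) : \bar R :=
  marginal P predT (initial k) x.

Definition observed_on A : pred (pattern V) :=
  [pred r : pattern V | [forall v in A, r v]].

Lemma marginal_pdf_set0 P A x r :
  marginal_pdf P A finset.set0 x r = fine (marginal P predT A x).
Proof.
congr fine; apply: eq_bigl => r'.
by apply/forallP => v; rewrite inE.
Qed.

Lemma marginal_pdf_observed P A B x :
  marginal_pdf P A B x [ffun=> true] = fine (marginal P (observed_on B) A x).
Proof.
congr fine; apply: eq_bigl => r'; apply: eq_forallb => v.
by rewrite ffunE eqb_id.
Qed.

Lemma X_conditional_pdfE P j x :
  X_conditional_pdf P [set s j]%SET (predecessors s j) x =
  fine (target_marginal P j.+1 x) / fine (target_marginal P j x).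
Proof.
rewrite /X_conditional_pdf /conditional_pdf !marginal_pdf_set0.
by rewrite /target_marginal -initialS.
Qed.

Lemma marginal_set0 P x : marginal P predT finset.set0 x = 1%E.
Proof.
transitivity (marginal P predT finset.set0 point).
  by apply: (depends_on_marginal P) => v; rewrite inE.
transitivity (I_ finset.set0 (marginal P predT finset.set0) point).
  by rewrite integral_over_set0.
rewrite integral_marginalT -[RHS](probability_setT (joint_law P)).
by congr (joint_law P _); apply/seteqP; split.
Qed.

Lemma marginal_fine_gt0 P (E : pred (pattern V)) A r : E r ->
  \forall x \ae product_law mu, marginal P E A x \is a fin_num /\
    0 < fine (marginal P E A x).
Proof.
move=> Er; move: (marginal_gt0 P A Er) (marginal_fin_num P E A).
apply: filterS2 => x m0 mfin; split => //.
by apply: fine_gt0; rewrite m0/= -ge0_fin_numE// ltW.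
Qed.

Definition ordered_independence P :=
  (forall j : 'I_n, j = 0%N :> nat ->
    X_indep_R P [set s j]%SET [set s j]%SET) /\
  (forall j : 'I_n, (0 < j)%N ->
    X_indep_R_given P [set s j]%SET (s j |: predecessors s j)%SET
        (predecessors s j)).

(** The conditional independence, read at the all-observed pattern, is
      p(x_<=j, R_<=j = 1) / p(x_<j)
        = p(x_<=j) / p(x_<j) * (p(x_<j, R_<=j = 1) / p(x_<j)).
    The unconditional hypothesis on the first variable has this form too, since
    p(x_<0) = 1. *)
Lemma X_conditional_pdf_observed P j : ordered_independence P ->
  \forall x \ae product_law mu,
    X_conditional_pdf P [set s j]%SET (predecessors s j) x =
    fine (marginal P (observed_on (initial j.+1)) (initial j.+1) x) /
    fine (marginal P (observed_on (initial j.+1)) (initial j) x).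
Proof.
move=> [hfirst hnext].
have o1 : observed_on (initial j.+1) [ffun=> true].
  by apply/forallP => v; rewrite ffunE implybT.
have indep : \forall x \ae product_law mu,
    fine (marginal P (observed_on (initial j.+1)) (initial j.+1) x) /
      fine (target_marginal P j x) =
    fine (target_marginal P j.+1 x) / fine (target_marginal P j x) *
    (fine (marginal P (observed_on (initial j.+1)) (initial j) x) /
      fine (target_marginal P j x)).
  have [j0|j0] := posnP j.
    have := hfirst j j0; rewrite /X_indep_R ae_target_law.
    apply: filterS => x /(_ [ffun=> true]).
    rewrite marginal_pdf_set0 !marginal_pdf_observed.
    have -> : [set s j]%SET = initial j.+1.
      by rewrite -initialS j0 initial0 finset.setU0.
    move=> h; rewrite /target_marginal j0 initial0 marginal_set0/= !divr1.
    by rewrite j0 in h *.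
  have := hnext j j0; rewrite /X_indep_R_given ae_target_law.
  apply: filterS => x /(_ [ffun=> true]).
  rewrite /conditional_pdf !marginal_pdf_set0 !marginal_pdf_observed.
  by rewrite finset.set0U -[predecessors s j]/(initial j) initialS.
move: indep (marginal_fine_gt0 P (initial j) o1)
  (@marginal_fine_gt0 P predT (initial j) point isT).
apply: filterS3 => x h [_ o0] [_ p0]; rewrite X_conditional_pdfE.
set a := fine (marginal P (observed_on _) (initial j.+1) x) in h *.
set b := fine (marginal P (observed_on _) (initial j) x) in h o0 *.
set p := fine (target_marginal P j x) in h *.
set q := fine (target_marginal P j.+1 x) / p in h *.
have p0' : p != 0 by rewrite gt_eqF.
have b0 : b != 0 by rewrite gt_eqF.
apply: (mulIf b0); rewrite divfK//.
by apply: (mulIf (invr_neq0 p0')); rewrite h mulrA.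
Qed.

Definition imputation_density P (m : nat) (x : X) : R :=
  \prod_(j < n | (m <= j)%N)
    X_conditional_pdf P [set s j]%SET (predecessors s j) x.

Lemma imputation_density_identified P P' :
  ordered_independence P -> ordered_independence P' ->
  (forall C, measurable C -> observed_law P C = observed_law P' C) ->
  \forall x \ae product_law mu, forall m,
    imputation_density P m x = imputation_density P' m x.
Proof.
move=> iP iP' PP'.
have : \forall x \ae product_law mu, forall j : 'I_n,
    X_conditional_pdf P [set s j]%SET (predecessors s j) x =
    X_conditional_pdf P' [set s j]%SET (predecessors s j) x.
  apply: filter_forall => j.
  have obs A : A \subset initial j.+1 ->
      forall r, observed_on (initial j.+1) r -> forall v, v \in A -> r v.
    move=> /fintype.subsetP sA r /forallP h v /sA vA.
    by have /implyP := h v; exact.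
  have sub : initial j \subset initial j.+1.
    by rewrite -initialS; exact: finset.subsetUr.
  have ratio : \forall x \ae product_law mu,
      fine (marginal P (observed_on (initial j.+1)) (initial j.+1) x) /
        fine (marginal P (observed_on (initial j.+1)) (initial j) x) =
      fine (marginal P' (observed_on (initial j.+1)) (initial j.+1) x) /
        fine (marginal P' (observed_on (initial j.+1)) (initial j) x).
    move: (marginal_identified PP' (obs _ (fintype.subxx _)))
      (marginal_identified PP' (obs _ sub)).
    by apply: filterS2 => x -> ->.
  move: (X_conditional_pdf_observed j iP) (X_conditional_pdf_observed j iP')
    ratio.
  by apply: filterS3 => x -> -> ->.
by apply: filterS => x h m; apply: eq_bigr.
Qed.

(** Stated without division, and with extended real marginals, so that it can be
    integrated as it stands. *)
Lemma imputation_density_telescope P (m : nat) : (m <= n)%N ->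
  \forall x \ae product_law mu,
    target_marginal P n x =
    (target_marginal P m x * (imputation_density P m x)%:E)%E.
Proof.
move=> mn.
have : \forall x \ae product_law mu, forall k : 'I_n.+1,
    target_marginal P k x \is a fin_num /\ 0 < fine (target_marginal P k x).
  by apply: filter_forall => k; exact: (@marginal_fine_gt0 P predT _ point isT).
apply: filterS => x h.
have fin k : (k <= n)%N -> target_marginal P k x \is a fin_num.
  by move=> kn; exact: (h (Ordinal (kn : (k < n.+1)%N))).1.
have gt0 k : (k <= n)%N -> fine (target_marginal P k x) != 0.
  by move=> kn; rewrite gt_eqF//; exact: (h (Ordinal (kn : (k < n.+1)%N))).2.
rewrite -(fineK (fin _ (leqnn n))) -(fineK (fin _ mn)) -EFinM; congr EFin.
rewrite /imputation_density; under eq_bigr do rewrite X_conditional_pdfE.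
rewrite -(big_mkord (fun k => m <= k)%N (fun k =>
  fine (target_marginal P k.+1 x) / fine (target_marginal P k x))).
rewrite (_ : \prod_(0 <= k < n | _) _ = \prod_(m <= k < n)
    (fine (target_marginal P k.+1 x) / fine (target_marginal P k x))).
  move: mn; rewrite leq_eqVlt => /predU1P[mn|mn].
    by rewrite mn big_geq// mulr1.
  rewrite telescope_prodf//; last by move=> k /andP[_ kn]; exact: gt0 (ltnW kn).
  by rewrite mulrC divfK// gt0// ltnW.
rewrite (big_cat_nat (n := m))//= big_nat_cond big1 ?mul1r.
  rewrite big_nat_cond [RHS]big_nat_cond; apply: eq_bigl => k.
  by rewrite andbT -andbA andbC; case: (m <= k)%N; rewrite ?andbF ?andbT.
by move=> k /andP[/andP[_ km]]; rewrite leqNgt km.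
Qed.

Lemma marginal_tower P A x :
  I_ (~: A)%SET (marginal P predT [set: V]%SET) x = marginal P predT A x.
Proof.
rewrite /marginal integral_over_sum//; last first.
  move=> r; apply: nonneg_measurable_integral_over.
  exact: nonneg_measurable_density.
by apply: eq_bigr => r _; rewrite finset.setCT integral_over_set0.
Qed.

Lemma X_conditional_pdf_ge0 P A C x : 0 <= X_conditional_pdf P A C x.
Proof.
rewrite /X_conditional_pdf /conditional_pdf !marginal_pdf_set0.
by rewrite divr_ge0// fine_ge0//; exact: (nonneg_measurable_marginal _ _ _).2.
Qed.

Lemma measurable_X_conditional_pdf P A C :
  measurable_fun setT (X_conditional_pdf P A C).
Proof.
have mf E B : measurable_fun setT (fun x : X => fine (marginal P E B x)).
  apply: (measurableT_comp (fine_measurable measurableT)).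
  exact: (nonneg_measurable_marginal _ _ _).1.
(* The inverse of a nonnegative real is its power of exponent -1, and powers
   with a fixed exponent are measurable functions. *)
rewrite (_ : X_conditional_pdf P A C =
  (fun x => fine (marginal P predT (A :|: C)%SET x) *
            (fine (marginal P predT C x)) `^ (-1))).
  apply: measurable_funM => //.
  exact: (measurableT_comp (measurable_powR _)).
apply/funext => x.
rewrite /X_conditional_pdf /conditional_pdf !marginal_pdf_set0.
by rewrite powR_inv1// fine_ge0//; exact: (nonneg_measurable_marginal _ _ _).2.
Qed.

Lemma nonneg_measurable_imputation_density P m :
  nonneg_measurable (fun x => (imputation_density P m x)%:E).
Proof.
split => [|x]; last first.
  by rewrite lee_fin prodr_ge0// => j _; exact: X_conditional_pdf_ge0.
apply/measurable_EFinP; rewrite /imputation_density.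
under eq_fun do rewrite -big_filter.
by apply: measurable_prod => j _; exact: measurable_X_conditional_pdf.
Qed.

(** Integrating the telescoped identity over the imputed variables gives
    p(x_<m) on one side and p(x_<m) times the mass on the other, since p(x_<m)
    does not depend on the imputed variables. *)
Lemma imputation_density_mass P (m : nat) : bijective s -> (m <= n)%N ->
  \forall x \ae product_law mu,
    I_ (~: initial m)%SET (fun y => (imputation_density P m y)%:E) x = 1%E.
Proof.
move=> bs mn.
have tm k := nonneg_measurable_marginal P predT (initial k).
have dm := nonneg_measurable_imputation_density P m.
move: (ae_slice (~: initial m)%SET (imputation_density_telescope P mn))
  (@marginal_fine_gt0 P predT (initial m) point isT).
apply: filterS2 => x eq_x [fin gt0].
have : I_ (~: initial m)%SET (fun y =>
    target_marginal P m y * (imputation_density P m y)%:E)%E x =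
    target_marginal P m x.
  rewrite -[RHS]marginal_tower -initial_full//.
  rewrite -!integral_over_measure//; last first.
    split=> [|y]; last by rewrite mule_ge0//; [exact: (tm m).2|exact: dm.2].
    by apply: emeasurable_funM; [exact: (tm m).1|exact: dm.1].
  apply: ge0_ae_eq_integral => //.
  - by apply: emeasurable_funM; [exact: (tm m).1|exact: dm.1].
  - exact: (tm n).1.
  - by move=> y _; rewrite mule_ge0//; [exact: (tm m).2|exact: dm.2].
  - by move=> y _; exact: (tm n).2.
  - by apply: filterS eq_x => y + _.
rewrite (@integral_over_mull _ _ _ _ mu _ (initial m))//.
- move: fin gt0; rewrite /target_marginal; case: marginal => // p _ /= p0.
  have := (nonneg_measurable_integral_over mu (~: initial m)%SET dm).2 x.
  case: (I_ _ _ x) => [a|_|//]; last by rewrite gt0_muley// lte_fin.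
  move=> _ [] pa; congr EFin; apply: (mulfI (lt0r_neq0 p0)).
  by rewrite pa mulr1.
- exact: (tm m).2.
- exact: depends_on_marginal.
- by rewrite -finset.setI_eq0 finset.setIC finset.setICr.
Qed.

End conditional_densities.

(** * The imputation kernels *)

Section density_kernels.
Context (R : realType) (V : finType) (d : V -> measure_display).
Variable T : forall v, measurableType (d v).
Variable mu : forall v, {sigma_finite_measure set (T v) -> \bar R}.
Local Open Scope ereal_scope.

Local Notation X := (Xspace T).
Local Notation I_ := (integral_over mu).

Definition extend (A : {set V}) (h : sub_space T A) : X := fun v =>
  match pselect (v \in A) with
  | left vA => h (exist _ v vA)
  | right _ => point
  end.

Lemma measurable_extend A : measurable_fun setT (@extend A).
Proof.
apply: measurable_to_prod_space => v; rewrite /extend.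
case: pselect => [vA|_]; last exact: measurable_cst.
exact: (measurable_coordinate _ (exist _ v vA : {v : V | v \in A})).
Qed.

Lemma measurable_restrict_to A :
  measurable_fun setT (@restrict_to V d T A).
Proof.
by apply: measurable_to_prod_space => v; exact: measurable_coordinate.
Qed.

Lemma extend_restrict_to (A : {set V}) (x : X) v :
  v \in A -> extend (@restrict_to V d T A x) v = x v.
Proof. by move=> vA; rewrite /extend; case: pselect => [//|]; rewrite vA. Qed.

Section density_kernel.
Variables (A : {set V}) (g : X -> \bar R).
Hypothesis g0 : nonneg_measurable g.

Definition density_kernel (h : sub_space T A)
    (B : set (sub_space T (~: A)%SET)) :=
  \int[over_measure mu (~: A)%SET (extend h)]_(y in
    @restrict_to V d T (~: A)%SET @^-1` B) g y.

Let mpre B : measurable B ->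
  measurable ((@restrict_to V d T (~: A)%SET) @^-1` B).
Proof.
move=> mB; rewrite -[X in measurable X]setTI.
exact: (@measurable_restrict_to (~: A)%SET).
Qed.

Let density_kernel0 h : density_kernel h set0 = 0.
Proof. by rewrite /density_kernel preimage_set0 integral_set0. Qed.

Let density_kernel_ge0 h B : 0 <= density_kernel h B.
Proof. by apply: integral_ge0 => y _; exact: g0.2. Qed.

Let density_kernel_additive h : semi_sigma_additive (density_kernel h).
Proof.
move=> F mF tF mUF; rewrite /density_kernel preimage_bigcup.
rewrite ge0_integral_bigcup//.
- apply: is_cvg_ereal_nneg_natsum => k _; exact: density_kernel_ge0.
- by move=> k; exact: mpre.
- exact: measurable_funTS g0.1.
- by move=> y _; exact: g0.2.
- by move=> i j _ _ [y [Fi Fj]]; apply: tF => //; exists (restrict_to y).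
Qed.

HB.instance Definition _ h := isMeasure.Build _ _ _ (density_kernel h)
  (density_kernel0 h) (density_kernel_ge0 h) (@density_kernel_additive h).

Definition density_kernel_measure : sub_space T A ->
  {measure set (sub_space T (~: A)%SET) -> \bar R} := density_kernel.

Lemma density_kernelE h B : measurable B -> density_kernel h B =
  I_ (~: A)%SET (fun y => (\1_B (restrict_to y))%:E * g y) (extend h).
Proof.
move=> mB; rewrite /density_kernel integral_mkcond epatch_indic.
rewrite -integral_over_measure; last first.
  exact: (nonneg_measurable_indicM (mpre mB) g0).
by apply: eq_integral => y _; rewrite /= muleC.
Qed.

Let measurable_density_kernel B : measurable B ->
  measurable_fun setT (density_kernel_measure ^~ B).
Proof.
move=> mB.
pose G := I_ (~: A)%SET (fun y => (\1_B (restrict_to y))%:E * g y).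
have mG : measurable_fun setT G.
  apply: (nonneg_measurable_integral_over mu _ _).1.
  exact: (nonneg_measurable_indicM (mpre mB) g0).
have -> : density_kernel_measure ^~ B = G \o @extend A.
  by apply/funext => h; rewrite /= density_kernelE.
exact: (measurableT_comp mG (@measurable_extend A)).
Qed.

HB.instance Definition _ := isKernel.Build _ _ _ _ R density_kernel_measure
  measurable_density_kernel.

(** Normalization makes the mass 1 at the exceptional points as well, and keeps
    measurability; it is the identity where the mass is already 1. *)
Definition imputation_kernel_of :
    R.-pker sub_space T A ~> sub_space T (~: A)%SET :=
  knormalize density_kernel_measure (dirac (point : sub_space T (~: A)%SET)).

Lemma imputation_kernel_ofE h B : measurable B ->
  I_ (~: A)%SET g (extend h) = 1 ->
  imputation_kernel_of h B =
  I_ (~: A)%SET (fun y => (\1_B (restrict_to y))%:E * g y) (extend h).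
Proof.
move=> mB mass; rewrite -density_kernelE//.
have kT : density_kernel h setT = 1.
  rewrite density_kernelE// -mass; congr (I_ _ _ (extend h)).
  by apply/funext => y; rewrite indicT mul1e.
by rewrite /= /mnormalize /= kT onee_eq0 /= invr1 mule1.
Qed.

End density_kernel.

Lemma eq_imputation_kernel_of A (g g' : X -> \bar R)
    (g0 : nonneg_measurable g) (g'0 : nonneg_measurable g') :
  g = g' ->
  forall h B, imputation_kernel_of A g0 h B = imputation_kernel_of A g'0 h B.
Proof. by move=> gg'; subst g'; rewrite (Prop_irrelevance g0 g'0). Qed.

End density_kernels.

Section chosen_density.
Context (R : realType) (V : finType) (d : V -> measure_display).
Variable T : forall v, measurableType (d v).
Variable mu : forall v, {sigma_finite_measure set (T v) -> \bar R}.
Variables (M : set (missing_data_law mu)) (n : nat) (s : 'I_n -> V).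
Variable Q : probability (Xstar_space T * pattern V)%type R.

Definition compatible_densities : set (nat -> Xspace T -> R) :=
  [set g | exists P, [/\ M P,
    forall C, measurable C -> observed_law P C = Q C &
    g = imputation_density s P]].

(** The value 0 is used for laws that no member of the model induces. *)
Definition chosen_density : nat -> Xspace T -> R :=
  xget (fun _ _ => 0) compatible_densities.

Lemma nonneg_measurable_chosen_density m :
  nonneg_measurable (fun x => (chosen_density m x)%:E).
Proof.
rewrite /chosen_density; case: xgetP => [g _ [P [_ _ ->]]|_].
  exact: nonneg_measurable_imputation_density.
by split => // ; exact: measurable_cst.
Qed.

End chosen_density.

(** The compatible densities are the same set for [Q] and [Q'], and the chosen
    element depends only on the set. *)
Lemma eq_chosen_density (R : realType) (V : finType) (d : V -> measure_display)
    (T : forall v, measurableType (d v))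
    (mu : forall v, {sigma_finite_measure set (T v) -> \bar R})
    (M : set (missing_data_law mu)) (n : nat) (s : 'I_n -> V)
    (Q Q' : probability (Xstar_space T * pattern V)%type R) :
  (forall C, measurable C -> Q C = Q' C) ->
  chosen_density M s Q = chosen_density M s Q'.
Proof.
move=> QQ'; congr xget; apply/seteqP.
by split => g [P [MP PQ ->]]; exists P; split => // C mC; rewrite PQ// QQ'.
Qed.

Lemma first_missing_le (V : finType) (n : nat) (s : 'I_n -> V) (r : pattern V) :
  (first_missing s r <= n)%N.
Proof. by rewrite -[leqRHS](size_enum_ord n) find_size. Qed.

Lemma observed_before_first_missing (V : finType) (n : nat) (s : 'I_n -> V)
    (r : pattern V) (v : V) :
  v \in initial s (first_missing s r) -> r v.
Proof.
case/imsetP => j; rewrite inE => jm ->.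
by have := before_find j jm; rewrite nth_ord_enum => /negbFE.
Qed.

Theorem theorem2p6 (R : realType) (V : finType) (n : nat) (hn : #|V| = n)
    (d : V -> measure_display) (T : forall v, measurableType (d v))
    (mu : forall v, {sigma_finite_measure set (T v) -> \bar R})
    (M : set (missing_data_law mu))
    (s : 'I_n -> V) (hs : bijective s)
    (hfirst : forall P, M P -> forall j : 'I_n, j = 0%N :> nat ->
      X_indep_R P [set s j]%SET [set s j]%SET)
    (hnext : forall P, M P -> forall j : 'I_n, (0 < j)%N ->
      X_indep_R_given P [set s j]%SET (s j |: predecessors s j)%SET
        (predecessors s j)) :
  exists K : imputation_method R T, directly_factorizable s M K.
Proof.
have indep P : M P -> ordered_independence s P.
  by move=> MP; split; [exact: hfirst|exact: hnext].
pose kernel Q r := imputation_kernel_of mu (initial s (first_missing s r))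
  (nonneg_measurable_chosen_density M s Q (first_missing s r)).
have kernel_ext (Q Q' : probability (Xstar_space T * pattern V)%type R) :
    (forall C, measurable C -> Q C = Q' C) ->
    forall r h B, measurable B -> kernel Q r h B = kernel Q' r h B.
  move=> QQ' r h B _; apply: eq_imputation_kernel_of.
  by rewrite (eq_chosen_density M s QQ').
exists (@ImputationMethod R V d T (fun r => initial s (first_missing s r))
  (@observed_before_first_missing V n s) kernel kernel_ext).
split=> [//|P MP r]; set m := first_missing s r.
pose Q := observed_law P.
have [P' [MP' P'Q gE]] : compatible_densities M s Q (chosen_density M s Q).
  by apply: xgetPex; exists (imputation_density s P); exists P.
have chosenE := imputation_density_identified (indep _ MP') (indep _ MP) P'Q.
apply/ae_target_law.
move: (imputation_density_mass P hs (first_missing_le s r))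
  (ae_slice (~: initial s m)%SET chosenE).
apply: filterS2 => x mass eq_x B mB.
have chosen0 := nonneg_measurable_chosen_density M s Q m.
have dens0 := nonneg_measurable_imputation_density s P m.
have mB' : measurable ((@restrict_to V d T (~: initial s m)%SET) @^-1` B).
  by rewrite -[X in measurable X]setTI; exact: measurable_restrict_to.
have extE f : integral_over mu (~: initial s m)%SET f
    (extend (@restrict_to V d T (initial s m) x)) =
    integral_over mu (~: initial s m)%SET f x.
  apply: (depends_on_integral_over mu (@depends_on_setT _ _ _ _ f)) => v.
  by rewrite !inE negbK andbT; exact: extend_restrict_to.
have densE : {ae over_measure mu (~: initial s m)%SET x, forall y,
    chosen_density M s Q m y = imputation_density s P m y}.
  by rewrite gE; apply: filterS eq_x => y; exact.
transitivity (integral_over mu (~: initial s m)%SET (fun y =>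
    (\1_B (restrict_to y))%:E * (chosen_density M s Q m y)%:E)%E x).
  rewrite -extE; apply: imputation_kernel_ofE => //.
  rewrite extE -mass -!integral_over_measure//.
  apply: ge0_ae_eq_integral => //.
  - exact: chosen0.1.
  - exact: dens0.1.
  - by move=> y _; exact: chosen0.2.
  - by move=> y _; exact: dens0.2.
  - by apply: filterS densE => y yE _; rewrite yE.
have chosenB0 := nonneg_measurable_indicM mB' chosen0.
have densB0 := nonneg_measurable_indicM mB' dens0.
rewrite -[RHS]/(integral_over mu (~: initial s m)%SET (fun y =>
    (\1_B (restrict_to y) * imputation_density s P m y)%:E) x).
rewrite -[LHS](integral_over_measure mu (~: initial s m)%SET x chosenB0).
rewrite -[RHS](integral_over_measure mu (~: initial s m)%SET x densB0).
apply: ge0_ae_eq_integral => //.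
- exact: chosenB0.1.
- exact: densB0.1.
- by move=> y _; exact: chosenB0.2.
- by move=> y _; exact: densB0.2.
- by apply: filterS densE => y yE _; rewrite yE.
Qed.
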